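(* Let $(X,d)$ be a compact metric space, let $f:X\to\mathbb{R}$ be continuous, let $M_f=\{x\in X: f(x)=\sup_{y\in X}f(y)\}$, and let $p:X\times\mathbb{R}\to\mathbb{R}$ be a convex extension of $f$. Then $p$ is a Birkhoff-James extension of $f$ if and only if there exist $x,y\in M_f$ such that $p_{t+}(x,0)\ge 0$ and $p_{t-}(y,0)\le 0$.
   Context: Metric spaces are assumed non-empty. Let $(X,d)$ be a compact metric space and $f:X\to\mathbb{R}$ continuous. Convex extension: a continuous function $p:X\times\mathbb{R}\to\mathbb{R}$ is a convex extension of $f$ if (i) $p(x,0)=f(x)$ for all $x\in X$, and (ii) for each $x\in X$ the function $t\mapsto p(x,t)$ is convex on $\mathbb{R}$. Birkhoff-James extension: a convex extension $p$ of $f$ is a Birkhoff-James extension of $f$ if $g(t)\ge g(0)$ for all $t\in\mathbb{R}$, where $g(t)=\sup_{x\in X}p(x,t)$. Notation: $p_{t+}(x_0,t_0)$ and $p_{t-}(x_0,t_0)$ denote respectively the right and left derivatives at $t_0$ of the function $t\mapsto p(x_0,t)$ (these exist by convexity). *)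

(* Defs.v *)
From mathcomp Require Import all_boot all_order all_algebra.
From mathcomp Require Import all_classical all_reals all_analysis.

Set Implicit Arguments.
Unset Strict Implicit.
Unset Printing Implicit Defensive.

Import Order.TTheory GRing.Theory Num.Theory.
Import numFieldNormedType.Exports.

Local Open Scope classical_set_scope.
Local Open Scope ring_scope.

(* One-sided derivatives.  [lim] is total: its value is meaningful only when
   the limit exists, which is the case for convex functions on the line. *)
Definition right_derivative (R : realType) (g : R -> R) (t0 : R) : R :=
  lim ((g (t0 + h) - g t0) / h @[h --> 0^'+]).

Definition left_derivative (R : realType) (g : R -> R) (t0 : R) : R :=
  lim ((g (t0 + h) - g t0) / h @[h --> 0^'-]).

Definition convex_extension (R : realType) (X : metricType R)
    (f : X -> R) (p : X * R -> R) : Prop :=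
  [/\ continuous p,
      forall x : X, p (x, 0) = f x &
      forall x : X,
        convex_function [set: R^o] (fun t : R^o => p (x, t))].

Definition birkhoff_james_extension (R : realType) (X : metricType R)
    (f : X -> R) (p : X * R -> R) : Prop :=
  let g (t : R) := sup (range (fun x : X => p (x, t))) in
  convex_extension f p /\ forall t : R, g 0 <= g t.

Definition maximum_set (R : realType) (X : metricType R) (f : X -> R) : set X :=
  [set x | f x = sup (range f)].

(* Main.v *)
(* By monotonicity of slopes, the one-sided conditions at 0 say that p (x, .)
   stays above sup f on t > 0, and p (y, .) on t < 0; this gives one direction.
   Conversely, if sup_x p (x, t) >= sup f for every t, then compactness yields a
   single x with p (x, t) >= sup f for all t > 0, and letting t tend to 0 shows
   that x is a maximum point of f; y comes from the reflection t -> - t. *)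
Require Import Defs.
From mathcomp Require Import all_boot all_order all_algebra.
From mathcomp Require Import all_classical all_reals all_analysis.
From mathcomp Require Import ring lra.

Import Order.TTheory GRing.Theory Num.Theory.
Import numFieldNormedType.Exports.

Local Open Scope classical_set_scope.
Local Open Scope ring_scope.

(** The point [y] is the convex combination of [x] and [z] with weight [(z - y) / (z - x)] on [x].
    Denominators are cleared so that [lra] and [nra] can use the inequality directly. *)
Lemma convex_function_chord (R : realType) (g : R -> R) :
  convex_function [set: R^o] g ->
  forall x y z : R, x < y -> y < z ->
    (z - x) * g y <= (z - y) * g x + (y - x) * g z.
Proof.
move=> cg x y z xy yz.
have zx0 : 0 < z - x by lra.
have zx_neq0 : z - x != 0 by rewrite gt_eqF.
pose k := (z - y) / (z - x).
have kE : k * (z - x) = z - y by rewrite divfK.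
have k01 : Itv.spec (@Itv.num_sem R) (Itv.Real `[0%Z, 1%Z]) k.
  rewrite /= /Itv.num_sem /= in_itv /= num_real /=.
  by apply/andP; split; rewrite /k ?ler_pdivlMr ?ler_pdivrMr //; lra.
have : g (k * x + (1 - k) * z) <= k * g x + (1 - k) * g z.
  exact: cg (Itv.mk k01) x z (in_setT _) (in_setT _).
have -> : k * x + (1 - k) * z = y.
  by rewrite (_ : _ + _ = z - k * (z - x)); [rewrite kE subKr | ring].
move=> /(ler_wpM2l (ltW zx0)) /le_trans; apply.
have -> : y - x = (1 - k) * (z - x) by rewrite mulrBl mul1r kE; ring.
rewrite -kE; lra.
Qed.

Lemma convex_function_opp (R : realType) (g : R -> R) :
  convex_function [set: R^o] g -> convex_function [set: R^o] (g \o -%R).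
Proof.
move=> cg k x y _ _ /=; have := cg k (- x) (- y) (in_setT _) (in_setT _).
by congr (g _ <= _); rewrite /conv /= !scalerN -opprD.
Qed.

(** By the chord inequality the difference quotient is nondecreasing in [h > 0] and bounded below,
    so it converges as [h] decreases to 0. *)
Lemma convex_right_derivative_cvg (R : realType) (g : R -> R) (t0 : R) :
  convex_function [set: R^o] g ->
  (g (t0 + h) - g t0) / h @[h --> 0^'+] --> right_derivative g t0.
Proof.
move=> /convex_function_chord cg; apply: (@nondecreasing_at_right_is_cvgr R).
  near=> b => r s; rewrite !in_itv /= => /andP[r0 _] /andP[s0 _].
  rewrite le_eqVlt => /orP[/eqP ->//|rs].
  have := cg t0 (t0 + r) (t0 + s).
  rewrite ler_pdivrMr // mulrAC ler_pdivlMr // => /(_ _ _)/[!(ltrDl, ltrD2l)].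
  by move=> /(_ r0 rs); lra.
(* The lower bound is the slope of the chord over [[t0 - 1, t0]]. *)
near=> b; exists (g t0 - g (t0 - 1)) => _ [h /= /[!in_itv] /= /andP[h0 _] <-].
rewrite ler_pdivlMr //.
have := cg (t0 - 1) t0 (t0 + h); rewrite ltrDl => /(_ _ h0).
by rewrite ltrBlDr ltrDl => /(_ ltr01); lra.
Unshelve. all: end_near. Qed.

(** The right derivative is the limit of slopes that shrink with [h], hence at most the slope from
    [t0] to any [t > t0]. Conversely, a limit of nonnegative quotients is nonnegative. *)
Lemma right_derivative_ge0P (R : realType) (g : R -> R) (t0 : R) :
  convex_function [set: R^o] g ->
  0 <= right_derivative g t0 <-> forall t, t0 < t -> g t0 <= g t.
Proof.
move=> cg; have cvgD := convex_right_derivative_cvg R g t0 cg; split.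
  move=> D0 t t0t; rewrite -subr_ge0.
  suff : right_derivative g t0 <= (g t - g t0) / (t - t0).
    by move=> /(le_trans D0); rewrite pmulr_lge0 // invr_gt0 subr_gt0.
  apply: limr_le; first exact: cvgP cvgD.
  near=> h.
  have h0 : 0 < h by [].
  have ht : h < t - t0 by near: h; apply: nbhs_right_lt; lra.
  rewrite ler_pdivrMr // mulrAC ler_pdivlMr; last by lra.
  have := convex_function_chord _ _ cg t0 (t0 + h) t.
  rewrite ltrDl => /(_ h0); rewrite -ltrBrDl => /(_ ht); lra.
move=> gt; apply: limr_ge; first exact: cvgP cvgD.
near=> h.
have h0 : 0 < h by [].
by apply: divr_ge0; [rewrite subr_ge0; apply: gt; lra | exact: ltW].
Unshelve. all: end_near. Qed.

Lemma left_derivative_opp (R : realType) (g : R -> R) (t0 : R) :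
  convex_function [set: R^o] g ->
  left_derivative g t0 = - right_derivative (g \o -%R) (- t0).
Proof.
move=> /convex_function_opp cg.
have /cvgN cvgD := convex_right_derivative_cvg _ _ (- t0) cg.
apply: cvg_lim => //; apply/cvg_at_leftNP; rewrite oppr0.
suff <- : \- (fun h => ((g \o -%R) (- t0 + h) - (g \o -%R) (- t0)) / h) =
          (fun h => (g (t0 + h) - g t0) / h) \o -%R by [].
by apply/funext => h /=; rewrite opprD !opprK invrN mulrN.
Qed.

Lemma left_derivative_le0P (R : realType) (g : R -> R) (t0 : R) :
  convex_function [set: R^o] g ->
  left_derivative g t0 <= 0 <-> forall t, t < t0 -> g t0 <= g t.
Proof.
move=> cg; rewrite left_derivative_opp // oppr_le0.
rewrite right_derivative_ge0P; last exact: convex_function_opp.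
rewrite /= opprK; split=> gt t tt0; last by apply: gt; rewrite ltrNl.
by rewrite -(opprK t); apply: gt; rewrite ltrN2.
Qed.

Lemma continuous_pairl (T U V : topologicalType) (p : T * U -> V) (u : U) :
  continuous p -> continuous (fun x => p (x, u)).
Proof.
move=> cp x; apply: (@continuous_comp _ _ _ (fun x => (x, u)) p); last exact: cp.
exact: cvg_pair cvg_id (cvg_cst _).
Qed.

Lemma continuous_pairr (T U V : topologicalType) (p : T * U -> V) (x : T) :
  continuous p -> continuous (fun u => p (x, u)).
Proof.
move=> cp u; apply: (@continuous_comp _ _ _ (fun u => (x, u)) p); last exact: cp.
exact: cvg_pair (cvg_cst _) cvg_id.
Qed.

(* The superlevel sets [{x | c <= p (x, t)}], [t > 0], increase with [t] by
   convexity, so they form a filter base of closed sets on a compact space. *)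
Lemma compact_convex_superlevel (R : realType) (X : topologicalType)
    (p : X * R -> R) (c : R) :
  compact [set: X] -> continuous p ->
  (forall x, convex_function [set: R^o] (fun t : R^o => p (x, t))) ->
  (forall x, p (x, 0) <= c) ->
  (forall t, 0 < t -> exists x, c <= p (x, t)) ->
  exists x, p (x, 0) = c /\ forall t, 0 < t -> c <= p (x, t).
Proof.
move=> cX ctp cvp p0 pt; pose K t := [set x | c <= p (x, t)].
have K_mono s t : 0 < s -> s <= t -> K s `<=` K t.
  move=> s0; rewrite le_eqVlt => /orP[/eqP->//|st] x; rewrite /K /= => cs.
  (* A convex function that is at most [c] at 0 and at least [c] at [s > 0] stays at least [c]
     beyond [s]. *)
  have := convex_function_chord _ _ (cvp x) 0 s t s0 st; have := p0 x; nra.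
have PF : ProperFilter (filter_from [set t : R | 0 < t] K).
  apply: filter_from_proper => [|t /pt //].
  apply: filter_from_filter => [|s t s0 t0]; first by exists 1; rewrite /= ltr01.
  have m0 : 0 < Num.min s t by rewrite lt_min s0.
  exists (Num.min s t) => // x Kx.
  by split; apply: K_mono Kx => //; rewrite ge_min lexx ?orbT.
(* Compactness gives a cluster point of the filter; it lies in every [K t] with [t > 0], since these
   sets are closed. *)
have [|x [_]] := cX _ PF; first by exists 1; rewrite /= ?ltr01.
rewrite clusterE => Fx.
have xt t : 0 < t -> c <= p (x, t).
  move=> t0; have cK : closed (K t).
    apply: (@closed_comp _ _ (fun x => p (x, t)) [set r | c <= r]).
      by move=> y _; exact: continuous_pairl.
    exact: closed_ge.
  by move/closure_id: cK => /seteqP[_]; apply; apply: Fx; exists t.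
exists x; split => //; apply/eqP; rewrite eq_le p0 /=.
have p_cvg : p (x, t) @[t --> 0^'+] --> p (x, 0).
  exact/cvg_at_right_filter/continuous_pairr.
rewrite -(cvg_lim (@Rhausdorff R) p_cvg); apply: limr_ge; first exact: cvgP p_cvg.
by near=> t; apply: xt.
Unshelve. all: end_near. Qed.

Lemma compact_sup_attained (R : realType) (X : topologicalType) (f : X -> R) :
  [set: X] !=set0 -> compact [set: X] -> continuous f ->
  (forall x, f x <= sup (range f)) /\ exists x, f x = sup (range f).
Proof.
move=> X0 cX cf.
have [|x _ fx] := compact_EVT_max X0 cX (f := f).
  exact: continuous_subspaceT.
have ubf : ubound (range f) (f x) by move=> _ [y _ <-]; apply: fx; rewrite inE.
have fsup y : f y <= sup (range f).
  by apply: ub_le_sup; [exists (f x) | exists y].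
split=> //; exists x; apply/eqP; rewrite eq_le fsup /=.
by apply: ge_sup => //; exists (f x), x.
Qed.

Theorem theorem2p7 (R : realType) (X : metricType R) (f : X -> R)
    (p : X * R -> R)
    (X_nonempty : [set: X] !=set0)
    (X_compact : compact [set: X])
    (f_continuous : continuous f)
    (p_extension : convex_extension f p) :
  birkhoff_james_extension f p <->
  exists x y : X,
    [/\ maximum_set f x, maximum_set f y,
        0 <= right_derivative (fun t : R => p (x, t)) 0 &
        left_derivative (fun t : R => p (y, t)) 0 <= 0].
Proof.
have [ctp p0 cvp] := p_extension.
have [f_le _] := compact_sup_attained _ _ _ X_nonempty X_compact f_continuous.
have pt t := compact_sup_attained _ _ _ X_nonempty X_compact
  (continuous_pairl _ _ _ _ t ctp).
(* Since each supremum over [X] is attained, the condition on suprema becomes pointwise: for each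
   [t] some point has value at least [sup (range f)]. *)
have -> : birkhoff_james_extension f p <->
    forall t, exists x, sup (range f) <= p (x, t).
  have p0f : (fun x => p (x, 0)) = f by apply/funext.
  rewrite /birkhoff_james_extension /= p0f; split=> [[_ ft] t|ft].
    by have [_ [x xE]] := pt t; exists x; rewrite xE.
  by split=> // t; have [x /le_trans] := ft t; apply; apply: (pt t).1.
split=> [ft|[x [y [fx fy Dx Dy]]] t]; last first.
  have [t0|t0|->] := ltgtP t 0; last by exists x; rewrite p0 fx.
  - exists y; rewrite -fy -p0.
    exact: (left_derivative_le0P _ _ _ (cvp y)).1.
  - exists x; rewrite -fx -p0.
    exact: (right_derivative_ge0P _ _ _ (cvp x)).1.
have [||x [x0 xt]] := compact_convex_superlevel _ _ _ (sup (range f))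
  X_compact ctp cvp.
- by move=> x; rewrite p0.
- by move=> t _; exact: ft.
(* Applied to the reflected extension, the compactness argument gives a point that works for all
   [t < 0]. *)
pose q (z : X * R) := p (z.1, - z.2).
have ctq : continuous q.
  move=> z; apply: (@continuous_comp _ _ _ (fun z => (z.1, - z.2)) p); last exact: ctp.
  exact: cvg_pair cvg_fst (cvgN cvg_snd).
have cvq z : convex_function [set: R^o] (fun t : R^o => q (z, t)).
  exact: convex_function_opp (cvp z).
have [||y [y0 yt]] := compact_convex_superlevel _ _ _ (sup (range f))
  X_compact ctq cvq.
- by move=> z; rewrite /q /= oppr0 p0.
- by move=> t _; exact: (ft (- t)).
rewrite /q /= oppr0 in y0.
exists x, y; split; rewrite /maximum_set /= -?p0 //.
- by apply/right_derivative_ge0P => // t t0; rewrite x0 xt.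
- apply/left_derivative_le0P => // t t0; rewrite y0 -(opprK t).
  by apply: yt; rewrite oppr_gt0.
Qed.
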